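(* Let $G_1$ be an $r_1$-regular graph with $n_1$ vertices and $m_1$ edges and let $G_2$ be an arbitrary graph with $n_2$ vertices. Then the adjacency characteristic polynomial of the central vertex corona $G_1\odot G_2$ is (as an identity of rational functions in $x$) $$f(A(G_1\odot G_2),x)=x^{m_1-n_1}\prod_{j=1}^{n_2}(x-\lambda_j(G_2))^{n_1}\prod_{i=1}^{n_1}\Big(x^2+x-x\,\chi_{A(G_2)}(x)-r_1-xP(\lambda_i(G_1))+(x-1)\lambda_i(G_1)\Big).$$
   Context: All graphs are finite, simple and connected. For a graph $G$ on $n$ vertices, $A(G)$ is its adjacency matrix with eigenvalues $\lambda_1(G)\ge\lambda_2(G)\ge\dots\ge\lambda_n(G)$ (with multiplicity). For an $n\times n$ matrix $M$, $f(M,x)=\det(xI_n-M)$, and $\chi_M(x)=\mathbf 1^T(xI_n-M)^{-1}\mathbf 1$ is the sum of all entries of $(xI_n-M)^{-1}$ (the $M$-coronal). $P$ denotes the polynomial associated with $G_1$: if $G_1$ is connected $r_1$-regular on $n_1$ vertices with distinct adjacency eigenvalues $r_1=\theta_1,\theta_2,\dots,\theta_t$, then $P(x)=n_1\prod_{k=2}^t\frac{x-\theta_k}{r_1-\theta_k}$; thus $P(A(G_1))$ is the all-ones matrix, $P(r_1)=n_1$ and $P(\theta_k)=0$ for $k\ge2$. The central graph $C(G)$ of $G$ is obtained from $G$ by subdividing each edge of $G$ exactly once and joining all pairs of distinct vertices of $G$ that are nonadjacent in $G$. The central vertex corona $G_1\odot G_2$ is obtained by taking one copy of $C(G_1)$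 and $|V(G_1)|$ copies of $G_2$, and joining the vertex $v_i$ of $G_1$ (viewed in $C(G_1)$) to every vertex in the $i$-th copy of $G_2$, for each $i$. *)

(* Defs.v *)
From HB Require Import structures.
From mathcomp Require Import all_boot all_order all_algebra.
From mathcomp Require Import polyrcf.

Set Implicit Arguments.
Unset Strict Implicit.
Unset Printing Implicit Defensive.

Import Order.TTheory GRing.Theory Num.Theory.
Local Open Scope ring_scope.

(* Finite simple graphs; connectedness is a separate predicate. *)
Record sgraph := SGraph {
  vertex :> finType;
  adj : rel vertex;
  adj_sym : symmetric adj;
  adj_irrefl : irreflexive adj }.

Section Graphs.
Variable G : sgraph.

Definition edges : {set {set G}} :=
  [set e | [exists u : G, exists v : G, adj u v && (e == [set u; v])]].

Definition connected_graph : Prop :=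
  (0 < #|G|)%N /\ forall u v : G, connect (@adj G) u v.

Definition regular_graph (r : nat) : Prop :=
  forall u : G, #|[set v | adj u v]| = r.

(* The vertices of C(G): those of G, and one subdividing vertex per edge. *)
Definition central_vertex : finType := (G + {e : {set G} | e \in edges})%type.

Definition central_adj : rel central_vertex := fun a b =>
  match a, b with
  | inl u, inl v => (u != v) && ~~ adj u v
  | inl u, inr e => u \in val e
  | inr e, inl u => u \in val e
  | inr _, inr _ => false
  end.

Lemma central_adj_sym : symmetric central_adj.
Proof. by case=> [u|e] [v|f] //=; rewrite eq_sym adj_sym. Qed.

Lemma central_adj_irrefl : irreflexive central_adj.
Proof. by case=> [u|e] //=; rewrite eqxx. Qed.

Definition central_graph : sgraph :=
  SGraph central_adj_sym central_adj_irrefl.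

End Graphs.

Section Corona.
Variables G1 G2 : sgraph.

(* inr (v, w) is the vertex w of the copy of G2 attached to the vertex v. *)
Definition cvc_vertex : finType := (central_graph G1 + G1 * G2)%type.

Definition cvc_adj : rel cvc_vertex := fun a b =>
  match a, b with
  | inl c, inl d => adj c d
  | inl (inl u), inr (v, _) => u == v
  | inr (v, _), inl (inl u) => u == v
  | inl (inr _), inr _ => false
  | inr _, inl (inr _) => false
  | inr (u, w), inr (v, z) => (u == v) && adj w z
  end.

Lemma cvc_adj_sym : symmetric cvc_adj.
Proof.
case=> [[u|e]|[u w]] [[v|f]|[v z]] //=.
- by rewrite eq_sym adj_sym.
- by rewrite eq_sym adj_sym.
Qed.

Lemma cvc_adj_irrefl : irreflexive cvc_adj.
Proof. by case=> [[u|e]|[u w]] //=; rewrite ?adj_irrefl ?andbF ?eqxx. Qed.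

Definition central_vertex_corona : sgraph :=
  SGraph cvc_adj_sym cvc_adj_irrefl.

End Corona.

Section Spectra.
Variable R : rcfType.

Definition adjmx (G : sgraph) : 'M[R]_#|G| :=
  \matrix_(i, j) (adj (enum_val i) (enum_val j))%:R.

(* Roots of the characteristic polynomial in R, repeated according to
   multiplicity, in nonincreasing order ([rootsR] is increasing). *)
Definition spectrum (G : sgraph) : seq R :=
  let p := char_poly (adjmx G) in
  rev (flatten [seq nseq (mup a p) a | a <- rootsR p]).

(* eigenval G i is the eigenvalue usually numbered i + 1, for i < #|G|. *)
Definition eigenval (G : sgraph) (i : nat) : R := nth 0 (spectrum G) i.

(* The product ranges over the distinct eigenvalues other than r. *)
Definition assoc_poly (G : sgraph) (r : nat) : {poly R} :=
  #|G|%:R *: \prod_(a <- undup (spectrum G) | a != r%:R)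
               ((r%:R - a)^-1 *: ('X - a%:P)).

(* The inverse is taken over the field of rational functions R(x), where
   xI - M is always invertible. *)
Definition coronal n (M : 'M[R]_n) : {fraction {poly R}} :=
  ((const_mx 1 : 'rV_n) *m
   invmx (map_mx (@tofrac {poly R}) (char_poly_mx M)) *m
   (const_mx 1 : 'cV_n)) 0 0.

End Spectra.

(* Main.v *)
Require Import Defs.
From HB Require Import structures.
From mathcomp Require Import all_boot all_order all_algebra.
From mathcomp Require Import perm polyrcf complex.
From mathcomp Require Import ring.

Set Implicit Arguments.
Unset Strict Implicit.
Unset Printing Implicit Defensive.

Import Order.TTheory GRing.Theory Num.Theory.
Local Open Scope ring_scope.

(** The adjacency matrix of the corona has three blocks of rows: the vertices
    of [G1], the subdividing vertices, and the copies of [G2]. In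
    [x - A(G1 o G2)] the copies contribute the block [I (x) (x - A(G2))];
    eliminating it ([det_corona_copies]) yields the factor
    [f(A(G2), x) ^ n1] and subtracts the coronal [chi] of [A(G2)] from the
    diagonal entries at the vertices of [G1]. Eliminating next the subdividing
    vertices, whose block is [x I] ([det_central_edges]), yields [x ^ m1] and
    subtracts [x^-1 N N^T = x^-1 (A(G1) + r1 I)], where [N] is the incidence
    matrix. What is left is the matrix
    [(x + 1 - chi - r1 / x) I - J + (1 - 1 / x) A(G1)] with [J] all ones.

    An eigenbasis of [A(G1)] diagonalises this matrix as well
    ([det_reduced]). Indeed, since [G1] is connected and regular, an
    eigenvector for [r1] is constant and an eigenvector for any other
    eigenvalue has sum zero, so [J] acts on an eigenvector for [lambda] as
    multiplication by [P(lambda)], [P] being the associated polynomial of [G1]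
    ([eigenvector_sum]). Multiplying each of the
    [n1] factors by [x] gives the formula.

    The eigenvalues belong to the real closed field [R]: a symmetric matrix
    over [R] is diagonalisable over [R] ([symmetric_diagonalizable]), by the
    spectral theorem over [R[i]]. *)

(** * Symmetric matrices over a real closed field *)

(** Diagonalisability is read on the minimal polynomial, which is the same over
    [R] and over [R[i]], where its roots are simple and real. *)
Lemma symmetric_diagonalizable (R : rcfType) (n : nat) (A : 'M[R]_n) :
  A^T = A -> diagonalizable A.
Proof.
case: n A => [|n] A symA; first by rewrite (flatmx0 A); exact: diagonalizable0.
pose f : {rmorphism R -> R[i]} := real_complex R.
pose B := map_mx f A.
have hermB : B \is hermsymmx.
  apply: realsym_hermsym.
    apply/is_hermitianmxP; rewrite expr0 scale1r /B.
    by rewrite -[in LHS]symA; apply/matrixP => i j; rewrite !mxE.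
  by apply/mxOverP => i j; rewrite mxE; apply/complex_realP; exists (A i j).
have /hermitian_normalmx/orthomx_spectralP defB := hermB.
have /mxOverP realD := hermitian_spectral_diag_real hermB.
set Q := spectralmx B in defB; set d := spectral_diag B in defB realD.
have Qu : Q \in unitmx by exact: spectral_unit.
pose e i : R := complex.Re (d 0 i).
have eE i : d 0 i = f (e i) by apply/esym; exact: RRe_real.
apply/diagonalizableP; exists (undup [seq e i | i <- enum 'I_n.+1]).
  exact: undup_uniq.
rewrite -(dvdp_map f) -mxminpoly_map -/B defB -conjVmx //.
rewrite mxminpoly_uconj ?unitmx_inv // mxminpoly_diag (eq_map eE).
rewrite (map_comp f) undup_map_inj; last exact: fmorph_inj.
rewrite rmorph_prod big_map /= [X in _ %| X](_ : _ =
  \prod_(x <- undup [seq e i | i <- enum 'I_n.+1]) ('X - (f x)%:P)) //.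
by apply: eq_bigr => x _; rewrite rmorphB /= map_polyX map_polyC.
Qed.

(** * Matrices indexed by finite types *)

Lemma sum_delta (K : pzSemiRingType) (T : finType) (a : T) (h : T -> K) :
  \sum_b (a == b)%:R * h b = h a.
Proof.
rewrite (bigD1 a) //= eqxx mul1r big1 ?addr0 // => b.
by rewrite eq_sym => /negPf->; rewrite mul0r.
Qed.

Lemma sum_deltar (K : pzSemiRingType) (T : finType) (a : T) (h : T -> K) :
  \sum_b h b * (b == a)%:R = h a.
Proof.
rewrite (bigD1 a) //= eqxx mulr1 big1 ?addr0 // => b.
by move=> /negPf->; rewrite mulr0.
Qed.

(** The square matrix with entries [f a b], rows and columns being ordered by
    the enumeration of [T]. *)
Definition fmx (K : pzRingType) (T : finType) (f : T -> T -> K) : 'M[K]_#|T| :=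
  \matrix_(i, j) f (enum_val i) (enum_val j).

Section FiniteTypeMatrices.
Variable K : comNzRingType.

Lemma eq_fmx (T : finType) (f g : T -> T -> K) : f =2 g -> fmx f = fmx g.
Proof. by move=> fg; apply/matrixP => i j; rewrite !mxE fg. Qed.

Lemma fmxM (T : finType) (f g : T -> T -> K) :
  fmx f *m fmx g = fmx (fun a b => \sum_c f a c * g c b).
Proof.
apply/matrixP => i j; rewrite !mxE.
rewrite [RHS](reindex_onto enum_val enum_rank) => [|c _];
  last exact: enum_rankK.
by apply: eq_big => [k|k _]; rewrite ?enum_valK ?eqxx // !mxE.
Qed.

Lemma fmx_id (T : finType) :
  fmx (fun a b : T => (a == b)%:R) = 1%:M :> 'M[K]_#|T|.
Proof. by apply/matrixP => i j; rewrite !mxE (inj_eq enum_val_inj). Qed.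

Lemma det_fmx_diag (T : finType) (d : T -> K) :
  \det (fmx (fun a b : T => d a * (a == b)%:R)) = \prod_a d a.
Proof.
have -> : fmx (fun a b : T => d a * (a == b)%:R) =
    diag_mx (\row_i d (enum_val i)).
  by apply/matrixP => i j; rewrite !mxE (inj_eq enum_val_inj) mulr_natr.
rewrite det_diag.
rewrite [RHS](reindex_onto enum_val enum_rank) => [|c _];
  last exact: enum_rankK.
by apply: eq_big => [k|k _]; rewrite ?enum_valK ?eqxx // !mxE.
Qed.

(** The determinant does not depend on the order in which [T] is listed. *)
Lemma det_fmx_reindex (T : finType) (n : nat) (h : 'I_n -> T)
    (f : T -> T -> K) :
  bijective h -> \det (\matrix_(i, j) f (h i) (h j)) = \det (fmx f).
Proof.
move=> bij_h; have en : n = #|T| by rewrite -(bij_eq_card bij_h) card_ord.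
move: h bij_h; rewrite {n}en => h bij_h.
have inj_s : injective (enum_rank \o h).
  exact: inj_comp enum_rank_inj (bij_inj bij_h).
pose s : {perm 'I_#|T|} := perm inj_s.
have -> : \matrix_(i, j) f (h i) (h j) = row_perm s (col_perm s (fmx f)).
  by apply/matrixP => i j; rewrite !mxE !permE /= !enum_rankK.
rewrite row_permE col_permE !det_mulmx !det_perm mulrC -mulrA odd_permV.
by rewrite -expr2 sqrr_sign mulr1.
Qed.

(** The determinant of a matrix on a disjoint union, computed by eliminating
    the second block, whose inverse is [g]. *)
Lemma det_fmx_schur (S T : finType) (f : S + T -> S + T -> K)
    (g : T -> T -> K) :
  (forall a c, \sum_b f (inr a) (inr b) * g b c = (a == c)%:R) ->
  \det (fmx f) =
    \det (fmx (fun a b => f (inr a) (inr b))) *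
    \det (fmx (fun a b => f (inl a) (inl b) -
      \sum_c \sum_d f (inl a) (inr c) * g c d * f (inr d) (inl b))).
Proof.
move=> fgV.
pose h (i : 'I_(#|S| + #|T|)) : S + T :=
  match split i with inl j => inl (enum_val j) | inr j => inr (enum_val j) end.
pose h' (u : S + T) : 'I_(#|S| + #|T|) :=
  match u with
  | inl a => lshift _ (enum_rank a) | inr b => rshift _ (enum_rank b) end.
have hl j : h (lshift _ j) = inl (enum_val j).
  by rewrite /h -[lshift _ _]/(unsplit (inl j)) unsplitK.
have hr j : h (rshift _ j) = inr (enum_val j).
  by rewrite /h -[rshift _ _]/(unsplit (inr j)) unsplitK.
have bij_h : bijective h.
  exists h' => [i|[a|b]] /=; last 2 first.
  - by rewrite hl enum_rankK.
  - by rewrite hr enum_rankK.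
  by rewrite /h -[RHS]splitK; case: (split i) => j /=; rewrite enum_valK.
rewrite -(det_fmx_reindex f bij_h).
pose A := fmx (fun a b => f (inl a) (inl b)).
pose B : 'M_(#|S|, #|T|) :=
  \matrix_(i, j) f (inl (enum_val i)) (inr (enum_val j)).
pose C : 'M_(#|T|, #|S|) :=
  \matrix_(i, j) f (inr (enum_val i)) (inl (enum_val j)).
pose D := fmx (fun a b => f (inr a) (inr b)).
have -> : \matrix_(i, j) f (h i) (h j) = block_mx A B C D.
  apply/matrixP => i j; rewrite -(splitK i) -(splitK j).
  case: (split i) => i'; case: (split j) => j' /=;
  rewrite ?block_mxEul ?block_mxEur ?block_mxEdl ?block_mxEdr !mxE;
  by rewrite ?hl ?hr.
pose G := fmx g.
have DG : D *m G = 1%:M by rewrite fmxM (eq_fmx fgV) fmx_id.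
have /(congr1 determinant) :
    block_mx A B C D *m block_mx 1%:M 0 (- (G *m C)) 1%:M =
    block_mx (A - B *m G *m C) B 0 D.
  rewrite mulmx_block !mulmx1 !mulmx0 !add0r !mulmxN !mulmxA DG mul1mx.
  by rewrite subrr.
rewrite det_mulmx det_lblock !det1 !mulr1 det_ublock => ->.
rewrite mulrC; congr (_ * \det _); apply/matrixP => i j.
rewrite !mxE; congr (_ - _).
rewrite [RHS]exchange_big /=.
rewrite [RHS](reindex_onto enum_val enum_rank) => [|c _];
  last exact: enum_rankK.
apply: eq_big => [k|k _]; first by rewrite enum_valK eqxx.
rewrite !mxE big_distrl /=.
rewrite [RHS](reindex_onto enum_val enum_rank) => [|c _];
  last exact: enum_rankK.
by apply: eq_big => [l|l _]; rewrite ?enum_valK ?eqxx // !mxE.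
Qed.

End FiniteTypeMatrices.

(** If the rows of the invertible matrix [k] are eigenvectors of [m] for
    the eigenvalues [d a], the determinant of [m] is the product of the
    [d a]. *)
Lemma det_fmx_eigen (K : idomainType) (T : finType) (k l m : T -> T -> K)
    (d : T -> K) :
  (forall a c, \sum_b k a b * l b c = (a == c)%:R) ->
  (forall a c, \sum_b k a b * m b c = d a * k a c) ->
  \det (fmx m) = \prod_a d a.
Proof.
move=> klV kmE.
have kl1 : \det (fmx k) * \det (fmx l) = 1.
  by rewrite -det_mulmx fmxM (eq_fmx klV) fmx_id det1.
have k0 : \det (fmx k) != 0.
  by apply: contra_eq_neq kl1 => ->; rewrite mul0r eq_sym oner_eq0.
apply: (mulfI k0); rewrite -det_mulmx fmxM (eq_fmx kmE).
rewrite -(det_fmx_diag d) mulrC -det_mulmx fmxM; congr (\det _).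
apply: eq_fmx => a b; rewrite (bigD1 a) //= eqxx mulr1 big1 ?addr0 // => c.
by rewrite eq_sym => /negPf->; rewrite mulr0 mul0r.
Qed.

(** * The spectrum of a graph *)

Section Spectrum.
Variable (R : rcfType) (G : sgraph).

(** An eigenbasis of the adjacency matrix: the rows of [k] are eigenvectors
    with eigenvalues [d], and [l] is the inverse of [k]. *)
Lemma adj_eigenbasis :
  exists (k l : G -> G -> R) (d : G -> R),
    [/\ forall a c, \sum_b k a b * l b c = (a == c)%:R,
        forall a c, \sum_b k a b * (adj b c)%:R = d a * k a c &
        perm_eq (spectrum R G) [seq d a | a <- enum G]].
Proof.
have symA : (adjmx R G)^T = adjmx R G.
  by apply/matrixP => i j; rewrite !mxE adj_sym.
have [P Pu /(diagonalizable_forLR Pu)[d defA]] := symmetric_diagonalizable symA.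
rewrite mxpoly.conjVmx // in defA.
pose k (a b : G) := P (enum_rank a) (enum_rank b).
pose l (a b : G) := invmx P (enum_rank a) (enum_rank b).
pose e (a : G) := d 0 (enum_rank a).
have sumE (F : 'I_#|G| -> R) : \sum_b F (enum_rank b) = \sum_i F i.
  rewrite [RHS](reindex_onto enum_rank enum_val) => [|i _];
    last exact: enum_valK.
  by apply: eq_bigl => b; rewrite enum_rankK eqxx.
have klV a c : \sum_b k a b * l b c = (a == c)%:R.
  rewrite (sumE (fun i => P (enum_rank a) i * invmx P i (enum_rank c))).
  have /matrixP/(_ (enum_rank a) (enum_rank c)) := mulmxV Pu.
  by rewrite !mxE (inj_eq enum_rank_inj).
have kA a c : \sum_b k a b * (adj b c)%:R = e a * k a c.
  have PA : P *m adjmx R G = diag_mx d *m P.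
    by rewrite defA !mulmxA mulmxV ?mul1mx.
  have /matrixP/(_ (enum_rank a) (enum_rank c)) := PA.
  rewrite mul_diag_mx !mxE => <-; rewrite -sumE; apply: eq_bigr => b _.
  by rewrite mxE !enum_rankK.
exists k, l, e; split=> //.
have charE : char_poly (adjmx R G) =
    \prod_(x <- [seq e a | a <- enum G]) ('X - x%:P).
  rewrite big_map big_enum /= /char_poly.
  have -> : char_poly_mx (adjmx R G) =
      fmx (fun a b : G => 'X * (a == b)%:R - ((adj a b)%:R : R)%:P).
    by apply/matrixP => i j; rewrite !mxE mulr_natr (inj_eq enum_val_inj).
  apply: (det_fmx_eigen (k := fun a b => (k a b)%:P)
                        (l := fun a b => (l a b)%:P)) => a c.
    rewrite -(rmorph_nat (@polyC R)) -klV rmorph_sum.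
    by apply: eq_bigr => b _; rewrite -rmorphM.
  under eq_bigr do rewrite mulrBr; rewrite sumrB mulrBl; congr (_ - _).
    rewrite (bigD1 c) //= eqxx mulr1 big1 ?addr0 1?mulrC // => b /negPf->.
    by rewrite !mulr0.
  by rewrite -rmorphM -kA rmorph_sum; apply: eq_bigr => b _; rewrite -rmorphM.
(* Both lists contain [x] as often as the multiplicity of [x] as a root of
   the characteristic polynomial. *)
apply/allP => x _ /=; apply/eqP; rewrite /spectrum charE.
rewrite count_rev count_flatten -map_comp -[RHS]mu_prod_XsubC.
set p := \prod_(_ <- _) _.
have p0 : p != 0 by rewrite monic_neq0 ?monic_prod_XsubC.
have uniq_roots : uniq (rootsR p) by exact: uniq_roots.
have mem_roots : (x \in rootsR p) = root p x.
  by rewrite -(roots_on_rootsR p0) in_itv.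
rewrite sumnE big_map (eq_bigr (fun y => if y == x then mup x p else 0)%N);
  last first.
  by move=> y _ /=; rewrite count_nseq /=; case: eqP => [->|]; rewrite ?mul1n.
rewrite -big_mkcond /=.
case: (boolP (root p x)) => [rx|nrx].
  by rewrite -big_filter filter_pred1_uniq ?mem_roots // big_seq1.
rewrite mupNroot // big1_seq // => y /andP[/eqP->]; by rewrite mem_roots (negPf nrx).
Qed.

End Spectrum.

(** * Regular connected graphs *)

Section Regular.
Variables (R : rcfType) (G : sgraph) (r : nat).
Hypothesis regG : regular_graph G r.

Lemma sum_adj (K : pzRingType) (u : G) : \sum_v (adj u v)%:R = r%:R :> K.
Proof.
rewrite -(regG u) -natr_sum -sum1dep_card; congr _%:R.
by rewrite [RHS]big_mkcond; apply: eq_bigr => v _; case: (adj u v).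
Qed.

Lemma sum_adjr (K : pzRingType) (v : G) : \sum_u (adj u v)%:R = r%:R :> K.
Proof. by rewrite -(sum_adj K v); apply: eq_bigr => u _; rewrite adj_sym. Qed.

(** An eigenvector for the eigenvalue [r] is constant on a connected graph,
    because the sum of [(k u - k v) ^+ 2] over adjacent [u] and [v]
    vanishes. *)
Lemma eigenvector_degree_const (k : G -> R) :
  connected_graph G ->
  (forall c, \sum_b k b * (adj b c)%:R = r%:R * k c) -> forall a b, k a = k b.
Proof.
move=> [_ conG] kE.
have sum0 : \sum_u \sum_v (adj u v)%:R * (k u - k v) ^+ 2 = 0.
  have E u v : (adj u v)%:R * (k u - k v) ^+ 2 =
     k u ^+ 2 * (adj u v)%:R + k v ^+ 2 * (adj u v)%:R
       - (k u * (adj u v)%:R * k v) *+ 2.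
    by ring.
  under eq_bigr => u _ do under eq_bigr => v _ do rewrite E.
  under eq_bigr => u _ do rewrite sumrB big_split /= -mulr_sumr sum_adj.
  rewrite sumrB big_split /= [X in _ + X - _]exchange_big /=.
  under [X in _ + X - _]eq_bigr => u _ do rewrite -mulr_sumr sum_adjr.
  rewrite [X in _ - X]exchange_big /=.
  under [X in _ - X]eq_bigr => v _.
    rewrite sumrMnl -mulr_suml kE.
    over.
  rewrite -big_split -sumrB big1 // => u _ /=; ring.
have adj_eq u v : adj u v -> k u = k v.
  move=> uv; apply/eqP; rewrite -subr_eq0 -sqrf_eq0.
  have ge0 u' v' : 0 <= (adj u' v')%:R * (k u' - k v') ^+ 2.
    by rewrite mulr_ge0 ?ler0n ?sqr_ge0.
  have /eqP := sum0; rewrite psumr_eq0 => [/allP/(_ u)|u' _]; last first.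
    by apply: sumr_ge0.
  rewrite mem_index_enum => /(_ isT) /=; rewrite psumr_eq0 //.
  by move=> /allP/(_ v); rewrite mem_index_enum uv mul1r => /(_ isT).
move=> a b; have /connectP[p] := conG a b.
elim: p a => [|c p IHp] a /=; first by move=> _ ->.
by case/andP => /adj_eq-> /IHp IH /IH.
Qed.

(** Eigenvectors for other eigenvalues are orthogonal to the constants. *)
Lemma eigenvector_sum0 (k : G -> R) (d : R) :
  (forall c, \sum_b k b * (adj b c)%:R = d * k c) -> d != r%:R ->
  \sum_b k b = 0.
Proof.
move=> kE dr; have : \sum_c \sum_b k b * (adj b c)%:R = d * \sum_c k c.
  by rewrite mulr_sumr; apply: eq_bigr => c _.
rewrite exchange_big /=; under eq_bigr do rewrite -mulr_sumr sum_adj.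
rewrite -mulr_suml mulrC => /eqP; rewrite -subr_eq0 -mulrBl mulf_eq0.
by rewrite subr_eq0 eq_sym (negPf dr) => /eqP.
Qed.

Lemma assoc_poly_eigenval (a : R) : a \in spectrum R G ->
  (assoc_poly R G r).[a] = if a == r%:R then #|G|%:R else 0.
Proof.
move=> aG; rewrite /assoc_poly hornerZ horner_prod.
case: eqP => [->|/eqP ar].
  rewrite big1 ?mulr1 // => b br; rewrite hornerZ hornerXsubC mulVf //.
  by rewrite subr_eq0 eq_sym.
rewrite (big_rem a) /= ?mem_undup // ar hornerZ hornerXsubC subrr.
by rewrite mulr0 mul0r mulr0.
Qed.

(** The associated polynomial maps the adjacency matrix to the all-ones
    matrix, here read on eigenvectors. *)
Lemma eigenvector_sum (k : G -> R) (d : R) :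
  connected_graph G -> d \in spectrum R G ->
  (forall c, \sum_b k b * (adj b c)%:R = d * k c) ->
  forall c, \sum_b k b = (assoc_poly R G r).[d] * k c.
Proof.
move=> conG dG kE c; rewrite assoc_poly_eigenval //.
case: eqP => [dr|/eqP dr]; last by rewrite mul0r (eigenvector_sum0 kE dr).
rewrite dr in kE; have kc := eigenvector_degree_const conG kE.
by rewrite (eq_bigr (fun=> k c)) // sumr_const mulr_natl.
Qed.

(** The incidence matrix [N] satisfies [N *m N^T = A + r%:M]. *)
Lemma sum_incidence (K : pzRingType) (u v : G) :
  \sum_(e : {e : {set G} | e \in edges G}) (u \in val e)%:R * (v \in val e)%:R
    = (adj u v)%:R + r%:R * (u == v)%:R :> K.
Proof.
under eq_bigr => e _ do rewrite -natrM mulnb.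
rewrite -natr_sum -(natrM _ r) -natrD; congr _%:R.
rewrite -(big_sub (mem (edges G))
  (fun e : {set G} => ((u \in e) && (v \in e) : nat))) /=.
have edgeP (e : {set G}) :
    reflect (exists a b, adj a b /\ e = [set a; b]) (e \in edges G).
  rewrite inE; apply: (iffP existsP) => [[a]|[a [b [ab ->]]]].
    by move=> /existsP[b /andP[ab /eqP->]]; exists a, b.
  by exists a; apply/existsP; exists b; rewrite ab eqxx.
have edge_in a (e : {set G}) : e \in edges G -> a \in e ->
    exists2 b, adj a b & e = [set a; b].
  move=> /edgeP[b [c [bc ->]]]; rewrite !inE => /orP[] /eqP->.
    by exists c.
  by exists b; rewrite 1?adj_sym // setUC.
have adj_neq (a b : G) : adj a b -> a != b.
  by apply: contraTneq => ->; rewrite adj_irrefl.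
have [<-{v}|uv] := eqVneq u v.
  (* The edges containing [u] correspond to its neighbours. *)
  rewrite adj_irrefl add0n muln1 -(regG u).
  rewrite -(card_in_imset (f := fun v => [set u; v])); last first.
    move=> v w; rewrite !inE => uv _ /setP/(_ v); rewrite !inE eqxx orbT.
    by rewrite eq_sym (negPf (adj_neq _ _ uv)) => /esym/eqP.
  rewrite -sum1_card big_mkcond [RHS]big_mkcond; apply: eq_bigr => e _.
  rewrite andbb; case: ifPn => [eG|eG].
    case: (boolP (u \in e)) => [ue|ue].
      have [b ub ->] := edge_in u e eG ue.
      by case: imsetP => // -[]; exists b; rewrite ?inE.
    case: imsetP => // -[b _ eE]; by rewrite eE !inE eqxx in ue.
  case: imsetP => // -[b ub eE]; case/edgeP: eG.
  by exists u, b; split=> //; rewrite inE in ub.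
(* Only [[set u; v]] can be an edge containing both. *)
rewrite muln0 addn0 big_mkcond /= (bigD1 [set u; v]) //= big1 ?addn0.
  rewrite set21 set22 /=; case: ifPn => [uvG|nuvG].
    have [|b ub /setP/(_ v)] := edge_in u _ uvG; first by rewrite !inE eqxx.
    by rewrite !inE eqxx orbT eq_sym (negPf uv) => /esym/eqP->; rewrite ub.
  by case: (boolP (adj u v)) => // auv; case/edgeP: nuvG; exists u, v.
move=> e ne; case: ifPn => // eG; case: (boolP (u \in e)) => //= ue.
have [b ub eE] := edge_in u e eG ue; case: (boolP (v \in e)) => // ve.
case/eqP: ne; rewrite eE; congr [set _; _]; apply/eqP; move: ve.
by rewrite eE !inE eq_sym (negPf uv) eq_sym.
Qed.

End Regular.

(** * The characteristic polynomial of the corona *)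

Lemma prod_eigenval (R : rcfType) (K : comPzRingType) (G : sgraph)
    (d : G -> R) (h : R -> K) :
  perm_eq (spectrum R G) [seq d a | a <- enum G] ->
  \prod_(i < #|G|) h (eigenval R G i) = \prod_a h (d a).
Proof.
move=> dG; have szG : size (spectrum R G) = #|G|.
  by rewrite (perm_size dG) size_map -cardE.
rewrite -szG -(big_mkord xpredT (fun i => h (nth 0 (spectrum R G) i))).
by rewrite -(big_nth 0 xpredT h) (perm_big _ dG) big_map big_enum.
Qed.

Section Corona.
Variable R : rcfType.
Local Notation F := {fraction {poly R}}.
Local Notation x := (tofrac 'X : F).
Local Notation cst a := (tofrac (a%:P : {poly R}) : F).

Lemma tofracX_neq0 : x != 0.
Proof. by rewrite tofrac_eq0 polyX_eq0. Qed.

Lemma char_poly_mx_fmx (G : sgraph) :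
  map_mx (@tofrac {poly R}) (char_poly_mx (adjmx R G)) =
  fmx (fun a b : G => x * (a == b)%:R - (adj a b)%:R).
Proof.
apply/matrixP => i j; rewrite !mxE (inj_eq enum_val_inj) rmorphB rmorphMn /=.
by rewrite mulr_natr !rmorph_nat.
Qed.

Lemma tofrac_char_poly (G : sgraph) :
  tofrac (char_poly (adjmx R G)) =
  \det (fmx (fun a b : G => x * (a == b)%:R - (adj a b)%:R)).
Proof. by rewrite -char_poly_mx_fmx det_map_mx. Qed.

(** The coronal is the sum of the entries of the inverse [g] of [x - A]. *)
Lemma coronal_inverse (G : sgraph) :
  exists2 g : G -> G -> F,
    forall a c, \sum_b (x * (a == b)%:R - (adj a b)%:R) * g b c = (a == c)%:R &
    coronal (adjmx R G) = \sum_a \sum_b g a b.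
Proof.
set M := map_mx (@tofrac {poly R}) (char_poly_mx (adjmx R G)).
have Mu : M \in unitmx.
  rewrite unitmxE unitfE det_map_mx tofrac_eq0 monic_neq0 //.
  exact: char_poly_monic.
exists (fun a b => invmx M (enum_rank a) (enum_rank b)) => [a c|].
  have /matrixP/(_ (enum_rank a) (enum_rank c)) := mulmxV Mu.
  rewrite !mxE (inj_eq enum_rank_inj) => <-.
  rewrite [RHS](reindex_onto enum_rank enum_val) => [|i _];
    last exact: enum_valK.
  apply: eq_big => [b|b _]; first by rewrite enum_rankK eqxx.
  by rewrite /M char_poly_mx_fmx mxE !enum_rankK.
rewrite /coronal -/M mxE exchange_big /=.
rewrite [LHS](reindex_onto enum_rank enum_val) => [|i _];
  last exact: enum_valK.
apply: eq_big => [b|b _]; first by rewrite enum_rankK eqxx.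
rewrite !mxE mulr1.
rewrite [LHS](reindex_onto enum_rank enum_val) => [|i _];
  last exact: enum_valK.
apply: eq_big => [a|a _]; first by rewrite enum_rankK eqxx.
by rewrite mxE mul1r.
Qed.

Variables G1 G2 : sgraph.

(** The block of the copies of the second graph. An eigenbasis of [A(G2)],
    repeated on each copy, diagonalises it. *)
Lemma det_copies :
  \det (fmx (fun p q : G1 * G2 =>
      x * (p == q)%:R - ((p.1 == q.1) && adj p.2 q.2)%:R)) =
  \prod_(j < #|G2|) (x - cst (eigenval R G2 j)) ^+ #|G1|.
Proof.
have [k [l [d [klV kA dG]]]] := adj_eigenbasis R G2.
rewrite (prod_eigenval (fun a => (x - cst a) ^+ #|G1|) dG).
rewrite (det_fmx_eigen
  (k := fun p q => (p.1 == q.1)%:R * cst (k p.2 q.2))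
  (l := fun p q => (p.1 == q.1)%:R * cst (l p.2 q.2))
  (d := fun p => x - cst (d p.2))).
- rewrite -(pair_bigA _ (fun _ b => x - cst (d b))) /= exchange_big /=.
  by apply: eq_bigr => b _; rewrite prodr_const.
- move=> [u w] [v z] /=.
  rewrite -(pair_bigA _ (fun u' w' => (u == u')%:R * cst (k w w') *
     ((u' == v)%:R * cst (l w' z)))) /=.
  under eq_bigr => u' _.
    under eq_bigr do rewrite -mulrA (mulrCA (cst _)).
    rewrite -mulr_sumr -mulr_sumr.
    over.
  rewrite sum_delta xpair_eqE -mulnb natrM; congr (_ * _).
  rewrite -(rmorph_nat (@tofrac {poly R})) -(rmorph_nat (@polyC R)) -klV.
  by rewrite !rmorph_sum; apply: eq_bigr => b _; rewrite !rmorphM.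
- move=> [u w] [v z] /=.
  rewrite -(pair_bigA _ (fun u' w' => (u == u')%:R * cst (k w w') *
     (x * ((u', w') == (v, z))%:R - ((u' == v) && adj w' z)%:R))) /=.
  under eq_bigr => u' _.
    under eq_bigr => w' _ do
      rewrite xpair_eqE -!mulnb !natrM mulrCA -mulrBr -mulrA (mulrCA (cst _)).
    rewrite -mulr_sumr -mulr_sumr.
    over.
  rewrite sum_delta mulrCA; congr (_ * _).
  under eq_bigr do rewrite mulrBr mulrCA; rewrite sumrB -mulr_sumr sum_deltar.
  rewrite mulrBl; congr (_ - _).
  rewrite -tofracM -polyCM -kA !rmorph_sum; apply: eq_bigr => b _.
  by rewrite !rmorphM !rmorph_nat.
Qed.

(** Eliminating the copies, whose block has the inverse [I (x) g] for [g] the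
    inverse of [x - A(G2)], subtracts the coronal at the vertices of the first
    graph. *)
Lemma det_corona_copies :
  tofrac (char_poly (adjmx R (central_vertex_corona G1 G2))) =
  \prod_(j < #|G2|) (x - cst (eigenval R G2 j)) ^+ #|G1| *
  \det (fmx (fun a b : central_graph G1 => x * (a == b)%:R - (adj a b)%:R -
    if a is inl _ then coronal (adjmx R G2) * (a == b)%:R else 0)).
Proof.
have [g gV ->] := coronal_inverse G2.
rewrite tofrac_char_poly.
rewrite (@det_fmx_schur _ (central_graph G1) (G1 * G2)%type _
  (fun p q => (p.1 == q.1)%:R * g p.2 q.2)); last first.
  move=> [u w] [v z] /=.
  transitivity (\sum_u' \sum_w' (x * ((u == u') && (w == w'))%:R
       - ((u == u') && adj w w')%:R) * ((u' == v)%:R * g w' z)).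
    rewrite pair_bigA; apply: eq_bigr => -[u' w'] _ /=.
    by rewrite (inj_eq (@inr_inj _ _)) xpair_eqE.
  under eq_bigr => u' _.
    under eq_bigr => w' _ do
      rewrite -!mulnb !natrM (mulrCA x) -mulrBr
        -mulrA (mulrCA (_ - _)).
    rewrite -mulr_sumr -mulr_sumr.
    over.
  by rewrite sum_delta gV xpair_eqE -natrM mulnb.
congr (_ * _).
  rewrite -det_copies; congr (\det _); apply: eq_fmx => -[u w] [v z] /=.
  by rewrite (inj_eq (@inr_inj _ _)).
congr (\det _); apply: eq_fmx => a b /=; rewrite (inj_eq (@inl_inj _ _)).
congr (_ - _); first by case: a.
case: a => [u|e]; last first.
  rewrite big1 // => p _; rewrite big1 // => q _.
  by case: p => p1 p2 /=; rewrite subr0 mulr0 !mul0r.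
case: b => [v|e]; last first.
  rewrite [RHS]mulr0 big1 // => p _; rewrite big1 // => q _.
  by case: q => q1 q2 /=; rewrite subr0 !mulr0.
rewrite (inj_eq (@inl_inj _ _)).
transitivity (\sum_(p : G1 * G2) \sum_(q : G1 * G2)
   (u == p.1)%:R * ((p.1 == q.1)%:R * (v == q.1)%:R * g p.2 q.2)).
  apply: eq_bigr => -[p1 p2] _; apply: eq_bigr => -[q1 q2] _ /=.
  by rewrite !mulr0 !sub0r; ring.
rewrite -(pair_bigA _ (fun p1 p2 => \sum_(q : G1 * G2)
   (u == p1)%:R * ((p1 == q.1)%:R * (v == q.1)%:R * g p2 q.2))) /=.
under eq_bigr => p1 _.
  under eq_bigr => p2 _ do rewrite -mulr_sumr.
  rewrite -mulr_sumr.
  over.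
rewrite sum_delta mulr_suml; apply: eq_bigr => w _.
rewrite -(pair_bigA _ (fun q1 q2 => (u == q1)%:R * (v == q1)%:R * g w q2)) /=.
under eq_bigr => q1 _.
  under eq_bigr => q2 _ do rewrite -mulrA.
  rewrite -!mulr_sumr.
  over.
by rewrite sum_delta mulrC eq_sym.
Qed.

(** Eliminating the subdividing vertices of a regular graph; the term [-1] is
    minus the all-ones matrix, from the edges between nonadjacent vertices. *)
Lemma det_central_edges (r : nat) (chi : F) : regular_graph G1 r ->
  \det (fmx (fun a b : central_graph G1 => x * (a == b)%:R - (adj a b)%:R -
    if a is inl _ then chi * (a == b)%:R else 0)) =
  x ^+ #|edges G1| *
  \det (fmx (fun u v : G1 => (x + 1 - chi - r%:R / x) * (u == v)%:R - 1 +
    (1 - x^-1) * (adj u v)%:R)).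
Proof.
move=> regG.
rewrite (@det_fmx_schur _ G1 {e : {set G1} | e \in edges G1} _
  (fun e f => x^-1 * (e == f)%:R)); last first.
  move=> e f /=; under eq_bigr => e' _.
    rewrite (inj_eq (@inr_inj _ _)) !subr0 mulrACA mulfV ?tofracX_neq0 // mul1r.
    over.
  by rewrite sum_delta.
congr (_ * _).
  rewrite (eq_fmx (g := fun e f => x * (e == f)%:R)); last first.
    by move=> e f /=; rewrite (inj_eq (@inr_inj _ _)) !subr0.
  by rewrite (det_fmx_diag (fun=> x)) prodr_const card_sig.
congr (\det _); apply: eq_fmx => u v /=; rewrite (inj_eq (@inl_inj _ _)).
have -> : \sum_(c : {e : {set G1} | e \in edges G1})
     \sum_(d : {e : {set G1} | e \in edges G1})
     (x * (inl u == inr c :> central_graph G1)%:R - (u \in val c)%:R -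
        chi * (inl u == inr c :> central_graph G1)%:R) *
     (x^-1 * (c == d)%:R) *
     (x * (inr d == inl v :> central_graph G1)%:R - (v \in val d)%:R - 0) =
   x^-1 * ((adj u v)%:R + r%:R * (u == v)%:R).
  rewrite -(sum_incidence regG) mulr_sumr; apply: eq_bigr => c _.
  under eq_bigr => d _.
    rewrite !mulr0 !sub0r !subr0 (_ : _ * _ * _ = (c == d)%:R *
      (x^-1 * ((u \in val c)%:R * (v \in val d)%:R))); last by ring.
    over.
  by rewrite sum_delta.
have -> : ((u != v) && ~~ adj u v)%:R = 1 - (u == v)%:R - (adj u v)%:R :> F.
  have [->|_] := eqVneq u v; first by rewrite adj_irrefl subrr subr0.
  by case: (adj u v); rewrite /= ?subr0 ?subrr.
ring.
Qed.

(** The reduced matrix is diagonalised by the eigenvectors of the first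
    graph. *)
Lemma det_reduced (r : nat) (c : F) :
  connected_graph G1 -> regular_graph G1 r ->
  \det (fmx (fun u v : G1 => c * (u == v)%:R - 1 + (1 - x^-1) * (adj u v)%:R)) =
  \prod_(i < #|G1|) (c - cst (assoc_poly R G1 r).[eigenval R G1 i] +
     (1 - x^-1) * cst (eigenval R G1 i)).
Proof.
move=> conG regG; have [k [l [d [klV kA dG]]]] := adj_eigenbasis R G1.
rewrite (prod_eigenval (fun a => c - cst (assoc_poly R G1 r).[a] +
  (1 - x^-1) * cst a) dG).
apply: (det_fmx_eigen (k := fun a b => cst (k a b))
                      (l := fun a b => cst (l a b))) => a b.
  rewrite -(rmorph_nat (@tofrac {poly R})) -(rmorph_nat (@polyC R)) -klV.
  by rewrite !rmorph_sum; apply: eq_bigr => v _; rewrite !rmorphM.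
have daG : d a \in spectrum R G1.
  by rewrite (perm_mem dG) map_f // mem_enum.
under eq_bigr do rewrite mulrDr mulrBr mulr1 mulrCA (mulrCA (cst _)).
rewrite big_split sumrB /= -!mulr_sumr sum_deltar.
rewrite [RHS]mulrDl [X in _ = X + _]mulrBl -[X in _ = _ + X]mulrA.
rewrite -!tofracM -!polyCM -kA.
rewrite -(eigenvector_sum regG conG daG (kA a)) !rmorph_sum.
congr (_ - _ + _ * _); apply: eq_bigr => v _.
by rewrite !rmorphM !rmorph_nat.
Qed.

End Corona.

Lemma clear_denominators (K : fieldType) (x chi r q : K) (m n : nat)
    (p a : 'I_n -> K) :
  x != 0 ->
  q * (x ^+ m *
    \prod_(i < n) (x + 1 - chi - r / x - p i + (1 - x^-1) * a i)) =
  x ^ (m%:Z - n%:Z) * q *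
    \prod_(i < n) (x ^+ 2 + x - x * chi - r - x * p i + (x - 1) * a i).
Proof.
move=> x0; rewrite expfzDr // -exprnP -exprnN.
under [in RHS]eq_bigr => i _.
  rewrite (_ : _ + _ = x * (x + 1 - chi - r / x - p i + (1 - x^-1) * a i));
    last by field.
  over.
rewrite big_split /= prodr_const card_ord.
set A := \prod_(_ < _) _; set y := x ^+ n.
have y0 : y != 0 by rewrite expf_neq0.
by field.
Qed.

Theorem theorem3p1 (R : rcfType) (G1 G2 : sgraph) (r1 n1 m1 n2 : nat)
    (hconn : connected_graph G1) (hreg : regular_graph G1 r1)
    (hn1 : #|G1| = n1) (hm1 : #|edges G1| = m1) (hn2 : #|G2| = n2) :
  let F := {fraction {poly R}} in
  let cst (a : R) : F := tofrac a%:P in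
  let x : F := tofrac 'X in
  let P := assoc_poly R G1 r1 in
  tofrac (char_poly (adjmx R (central_vertex_corona G1 G2))) =
    x ^ (m1%:Z - n1%:Z)
    * \prod_(j < n2) (x - cst (eigenval R G2 j)) ^+ n1
    * \prod_(i < n1)
        (x ^+ 2 + x - x * coronal (adjmx R G2) - r1%:R
         - x * cst P.[eigenval R G1 i] + (x - 1) * cst (eigenval R G1 i)).
Proof.
move=> F cst x P; rewrite -hn1 -hm1 -hn2.
rewrite det_corona_copies (det_central_edges _ hreg) (det_reduced _ hconn hreg).
exact: (clear_denominators _ _ _ _ _ _ (tofracX_neq0 R)).
Qed.
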